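(* Let $r>0$ and $s$ be real numbers. Let $e_0,e_1,e_2,\dots$ be independent and identically distributed real random variables with cumulative distribution function $F$ having probability density function $f$. Let $X_0$ be a real random variable such that $(X_0,e_0)$ is independent of $(e_1,e_2,\dots)$, and define $X_i - rX_{i-1} = e_i + s e_{i-1}$ for $i\ge 1$. Fix $x\in\mathbb{R}$, put $M_0=-\infty$, $M_n=\max_{1\le i\le n}X_i$ for $n\ge1$, and $u_n=P(M_n\le x)$ for $n\ge 0$. Let $G_0(\mathbf{y})=P(X_0\le y_0,\ e_0\le y_1)$ for $\mathbf{y}=(y_0,y_1)\in\mathbb{R}^2$. Define the linear operator $\mathcal{K}$ on functions $h$ of $\mathbf{z}=(z_0,z_1)\in\mathbb{R}^2$ by $$\mathcal{K}h(\mathbf{y}) = r\int\int_{a_{\mathbf{y}\mathbf{z}}}^{\infty} dz_0\, f(y_{0x}-rz_0-sz_1)\, h(z_0,dz_1),$$ where $y_{0x}=\min(y_0,x)$, $a_{\mathbf{y}\mathbf{z}}=(y_{0x}-sz_1-y_1)/r$, and $h(z_0,dz_1)$ denotes Lebesgue--Stieltjes integration in $z_1$. Set $a_n=[\mathcal{K}^nG_0(\mathbf{y})]_{\mathbf{y}=(\infty,\infty)}$ for $n\ge 0$. Then $u_n=a_n$ for all $n\ge 0$.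
   Context: Evaluation at $\mathbf{y}=(\infty,\infty)$ means the limit as $y_0\to\infty$ and $y_1\to\infty$. $\mathcal{K}^0$ is the identity, so $a_0=1$. *)

(* Defs.v *)
From HB Require Import structures.
From mathcomp Require Import all_boot all_order all_algebra.
From mathcomp Require Import all_classical all_reals all_analysis.
Set Implicit Arguments. Unset Strict Implicit. Unset Printing Implicit Defensive.
Import Order.TTheory GRing.Theory Num.Theory.
Import numFieldNormedType.Exports.
Local Open Scope classical_set_scope.
Local Open Scope ring_scope.

Definition indep_classes {d} {T : measurableType d} {R : realType}
  (P : probability T R) (C1 C2 : set (set T)) : Prop :=
  forall A B, C1 A -> C2 B -> P (A `&` B) = (P A * P B)%E.

Definition mutual_indep {d} {T : measurableType d} {R : realType}
  (P : probability T R) (C : nat -> set (set T)) : Prop :=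
  forall (s : seq nat) (A : nat -> set T), uniq s ->
    (forall i, i \in s -> C i (A i)) ->
    fine (P (\big[setI/setT]_(i <- s) A i)) = \prod_(i <- s) fine (P (A i)).

Definition sigma_of {d} {T : measurableType d} {d'} {U : measurableType d'}
  (X : T -> U) : set (set T) := preimage_set_system setT X measurable.

(** Lebesgue--Stieltjes measure of a function g : R -> R, i.e. the (Borel)
    measure mu with mu(]a,b]) = g b - g a for all a <= b; it exists (and is
    unique) when g is nondecreasing and right-continuous.  When no such
    measure exists we default to the zero measure (irrelevant here). *)
Definition LSmeasure {R : realType} (g : R -> R) : set R -> \bar R :=
  match pselect (exists mu : {measure set R -> \bar R},
      forall a b : R, a <= b -> mu `]a, b]%classic = (g b - g a)%:E) with
  | left H => (projT1 (cid H) : set R -> \bar R)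
  | right _ => (fun _ => 0%E)
  end.

Definition Kop {R : realType} (r s x : R) (f : R -> R)
  (h : R * R -> R) (y : R * R) : R :=
  let y0x := Order.min y.1 x in
  r * fine (\int[lebesgue_measure]_z0
     \int[LSmeasure (fun z1 => h (z0, z1))]_z1
        (if (y0x - s * z1 - y.2) / r <= z0
         then f (y0x - r * z0 - s * z1) else 0)%:E).

(* Main.v *)
Require Import Defs.
From HB Require Import structures.
From mathcomp Require Import all_boot all_order all_algebra.
From mathcomp Require Import all_classical all_reals all_analysis.
From mathcomp Require Import measurable_realfun ring lra.
Import Order.TTheory GRing.Theory Num.Theory.
Import numFieldNormedType.Exports.
Local Open Scope classical_set_scope.
Local Open Scope ring_scope.

(** Let [G_n(y) = P(M_n <= x, X_n <= y_0, e_n <= y_1)].  One step of the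
    recursion is [K G_n = G_(n+1)].  Indeed [e_(n+1)] is independent of the past,
    so conditioning on [(X_n, e_n)] gives
      [G_(n+1)(y) = E[1(M_n <= x) F(min(y_0x - r X_n - s e_n, y_1))]];
    writing [F] as the integral of [f] and substituting
    [u = y_0x - r z_0 - s e_n], the bound [u <= y_0x - r X_n - s e_n] becomes
    [X_n <= z_0] and the bound [u <= y_1] becomes [a_yz <= z_0].  By Tonelli the
    [dz_0] integral may be taken last, and what remains inside is an integral
    against the Lebesgue-Stieltjes measure of [G_n(z_0, .)], which is the law of
    [e_n] on the event [M_n <= x, X_n <= z_0].  Letting [y] tend to infinity in
    [K^n G_0 = G_n] gives [u_n] by continuity from below. *)

(** * Integrals against restricted and image measures *)

(** The complement of [D] is null for the restricted measure, and the two measures agree on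
    measurable subsets of [D]. *)
Lemma ge0_integral_mrestr {d} {T : measurableType d} {R : realType}
    (mu : {measure set T -> \bar R}) (D : set T) (mD : measurable D)
    (h : T -> \bar R) :
  measurable_fun setT h -> (forall w, 0 <= h w)%E ->
  (\int[mrestr mu mD]_w h w = \int[mu]_(w in D) h w)%E.
Proof.
move=> mh h0.
rewrite (@ge0_negligible_integral _ _ _ (mrestr mu mD) setT (~` D))//;
  last 2 first.
- exact: measurableC.
- by change (mu (~` D `&` D) = 0%E); rewrite setICl measure0.
rewrite setTD setCK; apply: eq_measure_integral => A mA AD.
by change (mu (A `&` D) = mu A); rewrite setIidl.
Qed.

(* [pushforward] has a measure instance only once its measurability proof is
   known; carrying that proof lets unification find it. *)
Definition image_measure {d d'} {T : measurableType d} {U : measurableType d'}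
  {R : realType} (mu : set T -> \bar R) {g : T -> U}
  (mg : measurable_fun setT g) : set U -> \bar R := pushforward mu g.

Section image_measure_instances.
Context {d d'} {T : measurableType d} {U : measurableType d'} {R : realType}.
Variables (g : T -> U) (mg : measurable_fun setT g).

Lemma image_measure_semi_sigma_additive (mu : {measure set T -> \bar R}) :
  semi_sigma_additive (image_measure mu mg).
Proof.
exact: (@measure_semi_sigma_additive _ _ _
  (measure_function_pushforward__canonical__measure_function_Measure mu mg)).
Qed.

HB.instance Definition _ (mu : {measure set T -> \bar R}) :=
  isMeasure.Build _ _ _ (image_measure mu mg)
    (measure0 mu) (fun A => measure_ge0 mu (g @^-1` A))
    (image_measure_semi_sigma_additive mu).

Lemma image_measure_fin_num (mu : {finite_measure set T -> \bar R}) :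
  fin_num_fun (image_measure mu mg).
Proof.
move=> A mA; rewrite /image_measure /pushforward.
by apply: fin_num_measure; rewrite -[X in measurable X]setTI; exact: mg.
Qed.

HB.instance Definition _ (mu : {finite_measure set T -> \bar R}) :=
  Measure_isFinite.Build _ _ _ (image_measure mu mg) (image_measure_fin_num mu).

Lemma ge0_integral_image_measure (mu : {measure set T -> \bar R})
    (h : U -> \bar R) :
  measurable_fun setT h -> (forall u, 0 <= h u)%E ->
  (\int[image_measure mu mg]_u h u = \int[mu]_w h (g w))%E.
Proof. by move=> mh h0; rewrite /image_measure ge0_integral_pushforward. Qed.

End image_measure_instances.

(** * Affine substitution, Lebesgue-Stieltjes integrals and joint laws *)

(** The image of Lebesgue measure under [z |-> c - r * z], scaled by [r], gives every interval its
    length, so it is Lebesgue measure by uniqueness. *)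
Lemma lebesgue_integral_affine {R : realType} (r c : R) (h : R -> \bar R) :
  0 < r -> measurable_fun setT h -> (forall u, 0 <= h u)%E ->
  (\int[lebesgue_measure]_u h u =
   r%:E * \int[lebesgue_measure]_z h (c - r * z)%R)%E.
Proof.
move=> r0 mh h0.
pose g : measurableTypeR R -> measurableTypeR R := fun z : R => c - r * z.
have mg : measurable_fun setT g.
  by apply: measurable_funB => //; exact: measurable_funM.
pose rr : {nonneg R} := NngNum (ltW r0).
pose mu : {measure set (measurableTypeR R) -> \bar R} :=
  mscale rr (image_measure (@lebesgue_measure R) mg).
have E A : measurable A -> lebesgue_measure A = mu A.
  apply: lebesgue_measure_unique => _ [[a b] _ <-] /=.
  rewrite /mu /mscale/= /image_measure /pushforward /=.
  (* The map is decreasing, so the open and closed ends are exchanged. *)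
  have -> : g @^-1` `]a, b] = `[(c - b) / r, (c - a) / r[%classic.
    apply/seteqP; split => z; rewrite /= /g !in_itv/= ler_pdivrMr// ltr_pdivlMr//;
      move=> /andP[? ?]; apply/andP; split; nra.
  rewrite !lebesgue_measure_itv/= !lte_fin ltr_pM2r ?invr_gt0// ltrD2l ltrN2.
  case: ifPn => _; last by rewrite mule0.
  rewrite !EFinN -!EFinD -EFinM; congr EFin; field; exact: lt0r_neq0.
rewrite (@eq_measure_integral _ _ _ _ mu); last by move=> A mA _; exact: E.
by rewrite ge0_integral_mscale//= ge0_integral_image_measure.
Qed.

(** [LSmeasure] chooses some measure with the prescribed increments. Here [nu] is one, so the
    default branch is excluded, and the chosen one equals [nu] because both agree on half-open
    intervals. *)
Lemma integral_LSmeasure {R : realType} (g : R -> R)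
    (nu : {finite_measure set R -> \bar R}) :
  (forall t, nu `]-oo, t]%classic = (g t)%:E) ->
  forall h : R -> \bar R,
  (\int[LSmeasure g]_u h u = \int[nu]_u h u)%E.
Proof.
move=> nug.
have nuoc a b : a <= b -> nu `]a, b]%classic = (g b - g a)%:E.
  move=> ab; have -> : `]a, b]%classic = `]-oo, b] `\` `]-oo, a] :> set R.
    apply/seteqP; split => z; rewrite /= !in_itv/=.
      by move=> /andP[az zb]; split => //; rewrite leNgt az.
    by move=> [-> /negP]; rewrite -ltNge => ->.
  rewrite measureD//=; last by rewrite -ge0_fin_numE// fin_num_measure.
  rewrite setIidr; last first.
    by move=> z; rewrite /= !in_itv/= => /le_trans; apply.
  by rewrite !nug.
rewrite /LSmeasure; case: pselect => [H|[]]; last by exists nu.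
move=> h; case: cid => mu /= muE; apply: eq_measure_integral => A mA _.
(* An exhaustion of the line by sets of finite mass, as uniqueness requires. *)
pose I (k : nat) := `](- k%:R)%R, k%:R]%classic : set R.
apply: (measure_unique (@ocitv R) I) => //.
- exact: ocitvI.
- by move=> k; exact: is_ocitv.
- apply/seteqP; split => // z _.
  exists (Num.truncn `|z|).+1 => //=.
  have := truncnS_gt `|z|; rewrite /I/= in_itv/= ltr_norml => /andP[-> /ltW ->//].
- move=> _ [[a b] _ <-] /=.
  have [ab|/ltW ba] := leP a b; first by rewrite muE// nuoc.
  by rewrite set_itv_ge ?measure0// bnd_simp -leNgt.
- move=> k; rewrite muE ?ltry//.
  by rewrite (@le_trans _ _ 0)// oppr_le0.
Qed.

(** Factorization on rectangles identifies the joint law of [(W, V)] with a product measure, whose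
    value on [C] is the integral of the sections. *)
Lemma indep_joint_measure {d} {T : measurableType d} {R : realType}
    (M : {finite_measure set T -> \bar R}) (nu : {finite_measure set R -> \bar R})
    (W V : T -> R) :
  measurable_fun setT W -> measurable_fun setT V ->
  (forall A B, measurable A -> measurable B ->
    M (W @^-1` A `&` V @^-1` B) = M (W @^-1` A) * nu B)%E ->
  forall C : set (R * R), measurable C ->
  (M [set w | C (W w, V w)] = \int[M]_w nu (xsection C (W w)))%E.
Proof.
move=> mW mV ind C mC.
have mWV : measurable_fun setT (fun w => (W w, V w)).
  exact: measurable_fun_pair.
rewrite -(@ge0_integral_image_measure _ _ _ _ _ _ mW M (nu \o xsection C))//;
  last exact: measurable_fun_xsection.
by rewrite [LHS](_ : _ = image_measure M mWV C)// -(@product_measure_unique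
    _ _ _ _ _ (image_measure M mW) nu (image_measure M mWV))//.
Qed.

Lemma measurable_le_and {d} {T : measurableType d} {R : realType}
    (f1 g1 f2 g2 : T -> R) :
  measurable_fun setT f1 -> measurable_fun setT g1 ->
  measurable_fun setT f2 -> measurable_fun setT g2 ->
  measurable [set w | f1 w <= g1 w /\ f2 w <= g2 w].
Proof.
move=> mf1 mg1 mf2 mg2; rewrite -[X in measurable X]setTI.
have -> : [set w | f1 w <= g1 w /\ f2 w <= g2 w] =
    (fun w => (f1 w <= g1 w) && (f2 w <= g2 w)) @^-1` [set true].
  by apply/seteqP; split => w /=; [move=> [-> ->]|move=> /andP].
by apply: measurable_and => //; exact: measurable_fun_ler.
Qed.

Lemma integral_density_itv {R : realType} (f : R -> R) (t : R) :
  (\int[lebesgue_measure]_(u in `]-oo, t]) (f u)%:E =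
   \int[lebesgue_measure]_u (if u <= t then f u else 0)%:E)%E.
Proof.
rewrite integral_mkcond; apply: eq_integral => u _.
by rewrite patchE mem_setE in_itv/=; case: ifP.
Qed.

(** * One application of the operator to a joint distribution function *)

Section Kop_step.
Context {R : realType} {d} {T : measurableType d}.
Variables (M : {finite_measure set T -> \bar R}).
Variables (nu : {finite_measure set R -> \bar R}).
Variables (r s x : R) (f : R -> R) (X e V : T -> R).
Hypotheses (r0 : 0 < r) (mf : measurable_fun setT f) (f0 : forall t, 0 <= f t).
Hypothesis nuE : forall t, (nu `]-oo, t]%classic =
  \int[lebesgue_measure]_(u in `]-oo, t]) (f u)%:E)%E.
Hypotheses (mX : measurable_fun setT X) (me : measurable_fun setT e).
Hypothesis mV : measurable_fun setT V.
Let W w := r * X w + s * e w.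
(** [M] will be [P] restricted to a past event, possibly of mass below 1, whereas [nu] is the law of
    the new noise under [P] itself. Hence the second factor is [nu B] and not the [M]-mass of the
    event on [V]. *)
Hypothesis indWV : forall A B, measurable A -> measurable B ->
  (M (W @^-1` A `&` V @^-1` B) = M (W @^-1` A) * nu B)%E.

Let mW : measurable_fun setT W.
Proof. by apply: measurable_funD; exact: measurable_funM. Qed.

Lemma substitution_domainE (c b u z0 : R) (w : T) : z0 = (c - s * e w - u) / r ->
  (X w <= z0) && ((c - s * e w - b) / r <= z0) = (u <= Order.min (c - W w) b).
Proof.
move=> ->; rewrite ler_pM2r ?invr_gt0// ler_pdivlMr// le_min /W.
by congr andb; apply/idP/idP; lra.
Qed.

Lemma Kop_joint_cdf (y : R * R) :
  Kop r s x f (fun y => fine (M [set w | X w <= y.1 /\ e w <= y.2])) y =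
  fine (M [set w | W w + V w <= Order.min y.1 x /\ V w <= y.2]).
Proof.
case: y => y0 b; rewrite /Kop /=; move: (Order.min y0 x) => c.
(* The constraint [X w <= z0] hidden in the Stieltjes measure becomes an indicator, so that Tonelli
   applies on the whole product space. *)
pose k (p : measurableTypeR R * T) : \bar R :=
  (if (X p.2 <= p.1) && ((c - s * e p.2 - b) / r <= p.1)
   then f (c - r * p.1 - s * e p.2) else 0)%:E.
have me2 : measurable_fun setT (fun p : measurableTypeR R * T => e p.2).
  exact: measurableT_comp.
have mse2 : measurable_fun setT (fun p : measurableTypeR R * T => s * e p.2).
  exact: measurable_funM.
have mk : measurable_fun setT k.
  apply/measurable_EFinP; apply: measurable_fun_ifT => //.
    apply: measurable_and; apply: measurable_fun_ler => //.
      exact: measurableT_comp.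
    apply: measurable_funM => //; apply: measurable_funB => //.
    exact: measurable_funB.
  apply: (measurableT_comp mf); apply: measurable_funB => //.
  by apply: measurable_funB => //; exact: measurable_funM.
have k0 p : (0 <= k p)%E by rewrite /k; case: ifP => _; rewrite lee_fin.
have mXz z : measurable [set w | X w <= z].
  rewrite -[X in measurable X]setTI.
  have -> : [set w | X w <= z] = X @^-1` `]-oo, z]%classic.
    by apply/seteqP; split => w /=; rewrite in_itv.
  exact: mX.
(* For fixed [z0], the Stieltjes measure is the image under [e] of [M] restricted to [X w <= z0]. *)
have inner (z0 : R) :
    (\int[LSmeasure (fun z1 => fine (M [set w | X w <= z0 /\ e w <= z1])%R)]_z1
       (if ((c - s * z1 - b) / r <= z0)%R
        then f (c - r * z0 - s * z1)%R else 0)%:E = \int[M]_w k (z0, w))%E.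
  pose N : {finite_measure set R -> \bar R} :=
    image_measure (mrestr M (mXz z0)) me.
  rewrite (integral_LSmeasure _ N); last first.
    move=> t; rewrite fineK; last first.
      by apply: fin_num_measure; exact: measurable_le_and.
    by congr (M _); apply/seteqP; split => w; rewrite /= in_itv/= => -[].
  have mh : measurable_fun setT (fun z1 : R =>
      (if (c - s * z1 - b) / r <= z0 then f (c - r * z0 - s * z1) else 0)%:E).
    apply/measurable_EFinP; apply: measurable_fun_ifT => //.
      apply: measurable_fun_ler => //; apply: measurable_funM => //.
      by apply: measurable_funB => //; apply: measurable_funB.
    by apply: (measurableT_comp mf); exact: measurable_funB.
  rewrite ge0_integral_image_measure//; last first.
    by move=> z1; case: ifP => _; rewrite lee_fin.
  rewrite ge0_integral_mrestr//; last 2 first.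
  - exact: (measurableT_comp mh me).
  - by move=> z1; case: ifP => _; rewrite lee_fin.
  rewrite integral_mkcond; apply: eq_integral => w _.
  rewrite patchE /k/=; have [Xz|/negP Xz] := boolP (X w <= z0).
    by rewrite mem_set.
  by rewrite memNset.
under [in LHS]eq_integral do rewrite inner.
rewrite (fubini_tonelli k)//.
have rI : (r%:E * \int[M]_w \int[lebesgue_measure]_z0 k (z0, w) =
    M [set w | (W w + V w <= c)%R /\ (V w <= b)%R])%E.
  rewrite -ge0_integralZl//; last 3 first.
  - exact: measurable_fun_fubini_tonelli_G.
  - by move=> w _; exact: integral_ge0.
  - by rewrite lee_fin ltW.
  rewrite [RHS](@indep_joint_measure _ _ _ M nu W V mW mV indWV
    [set p | p.1 + p.2 <= c /\ p.2 <= b]); last first.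
    by apply: measurable_le_and => //; exact: measurable_funD.
  apply: eq_integral => w _.
  have -> : xsection [set p | p.1 + p.2 <= c /\ p.2 <= b] (W w) =
      `]-oo, Order.min (c - W w) b]%classic.
    apply/seteqP; split => v; rewrite /xsection /= inE/= in_itv/= le_min lerBrDl.
      by move=> [-> ->].
    by move=> /andP.
  rewrite nuE integral_density_itv.
  rewrite [RHS](lebesgue_integral_affine r (c - s * e w))//; last 2 first.
  - apply/measurable_EFinP; apply: measurable_fun_ifT => //.
    exact: measurable_fun_ler.
  - by move=> u; case: ifP => _; rewrite lee_fin.
  congr (_ * _)%E; apply: eq_integral => z0 _; rewrite /k /=.
  rewrite (@substitution_domainE c b (c - s * e w - r * z0))//; last first.
    by field; exact: lt0r_neq0.
  by rewrite addrAC.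
(* [Kop] applies [fine] before multiplying by [r]. Since [r > 0], finiteness of the product rules
   out an infinite integral, so [fine] commutes with the multiplication. *)
have : (r%:E * \int[M]_w \int[lebesgue_measure]_z0 k (z0, w))%E \is a fin_num.
  rewrite rI; apply: fin_num_measure; apply: measurable_le_and => //.
  exact: measurable_funD.
rewrite -rI.
move: (\int[M]_w _)%E => I; case: I => [I _ //||].
- by rewrite gt0_muley ?lte_fin.
- by rewrite gt0_muleNy ?lte_fin.
Qed.
End Kop_step.

(** * Independence of the next noise from the past *)

(** Both sides are finite measures in [E] that agree on a pi-system containing the whole space,
    hence on the sigma-algebra it generates. *)
Lemma indep_g_sigma_algebra {d} {T : measurableType d} {R : realType}
    (P : probability T R) (G : set (set T)) (C : set T) :
  G `<=` measurable -> setI_closed G -> G setT -> measurable C ->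
  (forall E, G E -> P (E `&` C) = P E * P C)%E ->
  forall E, <<s G >> E -> (P (E `&` C) = P E * P C)%E.
Proof.
move=> Gm GI GT mC ind E GE.
have PC0 : 0 <= fine (P C) by rewrite fine_ge0.
have mscaleE A : mscale (NngNum PC0) P A = (P A * P C)%E.
  by rewrite /mscale/= fineK ?fin_num_measure// muleC.
have -> : P (E `&` C) = mrestr P mC E by [].
rewrite -mscaleE.
apply: (@g_sigma_algebra_measure_unique _ _ _ G Gm (fun=> setT)) => //.
- by rewrite bigcup_const//; exists 0%N.
- by move=> A GA; rewrite [LHS](_ : _ = P (A `&` C))// ind// -mscaleE.
- move=> _; rewrite [X in (X < _)%E](_ : _ = P (setT `&` C))// setTI.
  by rewrite -ge0_fin_numE// fin_num_measure.
Qed.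

Section past.
Context {d} {T : measurableType d} {R : realType} (P : probability T R).
Variables (X0 : T -> R) (e : nat -> T -> R).
Hypothesis mX0 : measurable_fun setT X0.
Hypothesis me : forall n, measurable_fun setT (e n).

(** Only a pi-system generating the information of X_0, e_0, ..., e_n: on such intersections the
    independence hypotheses apply directly. *)
Definition past (n : nat) : set (set T) := [set E | exists B A,
  [/\ sigma_of (fun w => (X0 w, e 0%N w)) B, forall i, sigma_of (e i) (A i) &
   E = B `&` \big[setI/setT]_(i <- iota 1 n) A i]].

Lemma sigma_of_measurable {d'} {U : measurableType d'} (g : T -> U) :
  measurable_fun setT g -> sigma_of g `<=` measurable.
Proof. by move=> mg _ [B mB <-]; exact: mg. Qed.

Lemma sigma_ofT {d'} {U : measurableType d'} (g : T -> U) : sigma_of g setT.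
Proof. by exists setT => //; rewrite preimage_setT setTI. Qed.

Lemma sigma_ofI {d'} {U : measurableType d'} (g : T -> U) :
  setI_closed (sigma_of g).
Proof.
move=> _ _ [A mA <-] [B mB <-]; exists (A `&` B); first exact: measurableI.
by rewrite !setTI preimage_setI.
Qed.

Lemma past_measurable n : past n `<=` measurable.
Proof.
move=> _ [B [A [sB sA ->]]]; apply: measurableI.
  by apply: sigma_of_measurable sB; exact: measurable_fun_pair.
by apply: bigsetI_measurable => i _; exact: sigma_of_measurable (sA i).
Qed.

Lemma pastI n : setI_closed (past n).
Proof.
move=> _ _ [B [A [sB sA ->]]] [B' [A' [sB' sA' ->]]].
exists (B `&` B'), (fun i => A i `&` A' i); split.
- exact: sigma_ofI.
- by move=> i; exact: sigma_ofI.
- by rewrite big_split/= setIACA.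
Qed.

Lemma past_init n : sigma_of (fun w => (X0 w, e 0%N w)) `<=` past n.
Proof.
move=> B sB; exists B, (fun=> setT); split => //.
  by move=> i; exact: sigma_ofT.
by rewrite big1 ?setIT.
Qed.

Lemma past_noise n i : (1 <= i <= n)%N -> sigma_of (e i) `<=` past n.
Proof.
move=> i1n B sB.
exists setT, (fun j => if j == i then B else setT); split; first exact: sigma_ofT.
  by move=> j; case: eqP => [->//|_]; exact: sigma_ofT.
rewrite setTI (bigD1_seq i) ?iota_uniq//= ?mem_iota ?add1n ?ltnS//.
by rewrite eqxx big1 ?setIT// => j /negPf ->.
Qed.

(** Retyping the domain as [g_sigma_algebraType (past n)] expresses measurability with respect to
    the past, so the usual closure lemmas apply to it. *)
Lemma g_past_init n :
  measurable_fun setT (X0 : g_sigma_algebraType (past n) -> R) /\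
  measurable_fun setT (e 0%N : g_sigma_algebraType (past n) -> R).
Proof.
split=> _ B mB; rewrite setTI; apply: sub_sigma_algebra; apply: past_init.
  exists (B `*` setT); first exact: measurableX.
  by rewrite setTI; apply/seteqP; split => w //= -[].
exists (setT `*` B); first exact: measurableX.
by rewrite setTI; apply/seteqP; split => w //= -[].
Qed.

Lemma g_past_noise n i : (i <= n)%N ->
  measurable_fun setT (e i : g_sigma_algebraType (past n) -> R).
Proof.
case: i => [_|i ilen]; first exact: (g_past_init n).2.
move=> _ B mB; rewrite setTI; apply: sub_sigma_algebra.
by apply: (@past_noise n i.+1) => //; exists B => //; rewrite setTI.
Qed.

Hypothesis inde : mutual_indep P (fun n => sigma_of (e n)).
Hypothesis indX0 : indep_classes P (sigma_of (fun w => (X0 w, e 0%N w)))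
  (<<s setT, \bigcup_(i in [set i : nat | (0 < i)%N]) sigma_of (e i) >>).

(** It suffices to take [E] in the pi-system. There [indX0] splits off the event on (X_0, e_0), and
    [inde] then factors the events on e_1, ..., e_(n+1). *)
Lemma past_indep n (E C : set T) :
  <<s past n >> E -> sigma_of (e n.+1) C -> (P (E `&` C) = P E * P C)%E.
Proof.
move=> pE sC; apply: (@indep_g_sigma_algebra _ _ _ _ (past n)) => //.
- exact: past_measurable.
- exact: pastI.
- by apply: past_init; exact: sigma_ofT.
- exact: sigma_of_measurable sC.
move=> {pE}_ [B [A [sB sA ->]]].
pose F := \bigcup_(i in [set i : nat | (0 < i)%N]) sigma_of (e i).
have future m A' : (forall i, sigma_of (e i) (A' i)) ->
    <<s F >> (\big[setI/setT]_(i <- iota 1 m) A' i).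
  move=> sA'; rewrite big_seq.
  apply: (@bigsetI_measurable _ (g_sigma_algebraType F)) => i.
  rewrite mem_iota => /andP[i0 _]; apply: sub_sigma_algebra; exists i => //.
have prodP m A' : (forall i, sigma_of (e i) (A' i)) ->
    P (\big[setI/setT]_(i <- iota 1 m) A' i) =
    (\prod_(i <- iota 1 m) fine (P (A' i)))%:E.
  move=> sA'; rewrite -inde ?iota_uniq// fineK// fin_num_measure//.
  by apply: bigsetI_measurable => i _; exact: sigma_of_measurable (sA' i).
have iotaS : iota 1 n.+1 = iota 1 n ++ [:: n.+1] by rewrite -(iotaD 1 n 1) addn1.
(* Storing [C] at index [n.+1] makes the whole noise part one intersection over [iota 1 n.+1]. *)
pose A1 i := if i == n.+1 then C else A i.
have sA1 i : sigma_of (e i) (A1 i) by rewrite /A1; case: eqP => [->|].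
have A1E : \big[setI/setT]_(i <- iota 1 n) A i `&` C =
    \big[setI/setT]_(i <- iota 1 n.+1) A1 i.
  rewrite iotaS big_cat/= big_seq1 /A1 eqxx; congr (_ `&` _).
  rewrite !big_seq; apply: eq_bigr => i.
  rewrite mem_iota add1n ltnS => /andP[_ i_n].
  by rewrite ltn_eqF.
rewrite -setIA A1E !indX0//; [|exact: future|exact: future].
rewrite !prodP// -muleA; congr (_ * _)%E.
rewrite iotaS big_cat/= big_seq1 /A1 eqxx EFinM fineK; last first.
  by apply: fin_num_measure; exact: sigma_of_measurable sC.
congr (_%:E * _)%E; rewrite !big_seq; apply: eq_bigr => i.
by rewrite mem_iota add1n ltnS => /andP[_ i_n]; rewrite ltn_eqF.
Qed.

End past.

(** * Limit of joint distribution functions at infinity *)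

(** Continuity from below gives the limit along the diagonal [(k, k)]. Monotonicity in both
    coordinates, with the upper bound [P S], extends it to the product filter. *)
Lemma cvg_joint_cdf_pinfty {d} {T : measurableType d} {R : realType}
    (P : probability T R) (S : set T) (X e : T -> R) :
  measurable S -> measurable_fun setT X -> measurable_fun setT e ->
  (fun y : R * R => fine (P [set w | S w /\ X w <= y.1 /\ e w <= y.2]))
    @ filter_prod (pinfty_nbhs R) (pinfty_nbhs R) --> fine (P S).
Proof.
move=> mS mX me.
pose D (y : R * R) := [set w | S w /\ X w <= y.1 /\ e w <= y.2].
have mD y : measurable (D y).
  by apply: measurableI => //; exact: measurable_le_and.
have UD : \bigcup_k D (k%:R, k%:R) = S.
  apply/seteqP; split => [w [k _ []]//|w Sw].
  exists (Num.truncn (Num.max (X w) (e w))).+1 => //; split => //=.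
  by split; apply: ltW; apply: le_lt_trans (truncnS_gt (Num.max (X w) (e w)));
    rewrite le_max lexx ?orbT.
have PD : P (D (k%:R, k%:R)) @[k --> \oo] --> P S.
  rewrite -UD; apply: nondecreasing_cvg_mu => //; first by rewrite UD.
  move=> m k mk; apply/subsetPset => w [Sw [/= Xw ew]]; split => //=.
  by split; [apply: le_trans Xw _|apply: le_trans ew _]; rewrite ler_nat.
have {}PD : fine (P (D (k%:R, k%:R))) @[k --> \oo] --> fine (P S).
  by apply: fine_cvg; rewrite fineK// fin_num_measure.
apply/cvgrPdist_le => eps eps0; move/cvgrPdist_le : PD => /(_ _ eps0).
case=> k _ /(_ k (leqnn k)) Dk.
exists ([set t | k%:R <= t], [set t | k%:R <= t]).
  by split; apply: nbhs_pinfty_ge; rewrite num_real.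
move=> [y0 y1] [/= ky0 ky1].
have lS y : (fine (P (D y)) <= fine (P S)).
  by rewrite fine_le ?fin_num_measure// le_measure ?inE//; [move=> w []].
have Dle : fine (P (D (k%:R, k%:R))) <= fine (P (D (y0, y1))).
  rewrite fine_le ?fin_num_measure// le_measure ?inE//.
  move=> w [Sw [/= Xw ew]]; split => //=.
  by split; [exact: le_trans ky0|exact: le_trans ky1].
apply: le_trans Dk; rewrite !ger0_norm ?subr_ge0//; last exact: (lS (y0, y1)).
by rewrite lerD2l lerN2.
Qed.

(** * Adaptedness of the process and of the event that it stays below the level *)

Section recursion.
Context {d} {T : measurableType d} {R : realType}.
Variables (X0 : T -> R) (e X : nat -> T -> R) (r s x : R).
Hypothesis mX0 : measurable_fun setT X0.
Hypothesis me : forall n, measurable_fun setT (e n).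
Hypotheses (X0E : X 0%N = X0) (XS : forall i w, (1 <= i)%N ->
  X i w - r * X i.-1 w = e i w + s * e i.-1 w).

Lemma recE i w : X i.+1 w = r * X i w + s * e i w + e i.+1 w.
Proof. by have := XS i.+1 w (ltn0Sn i); rewrite /= => h; lra. Qed.

(** By [recE], each new value combines the previous one with two noises that already belong to the
    past. *)
Lemma g_past_process n i : (i <= n)%N ->
  measurable_fun setT (X i : g_sigma_algebraType (past X0 e n) -> R).
Proof.
elim: i => [_|i IHi i_n]; first by rewrite X0E; exact: (g_past_init _ _ n).1.
rewrite (_ : X i.+1 = fun w => r * X i w + s * e i w + e i.+1 w); last first.
  by apply/funext => w; exact: recE.
apply: measurable_funD; last exact: g_past_noise.
apply: measurable_funD; apply: measurable_funM => //; first exact: IHi (ltnW i_n).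
by apply: g_past_noise; exact: ltnW.
Qed.

(** The event M_n <= x written without a maximum; at [n = 0] it is the whole space, in accordance
    with M_0 = -oo. *)
Definition stay (n : nat) : set T :=
  [set w | forall i, (1 <= i <= n)%N -> X i w <= x].

Lemma stayS n : stay n.+1 = stay n `&` [set w | X n.+1 w <= x].
Proof.
apply/seteqP; split => [w sw|w [sw Xw] i /andP[i1]].
  split; last by apply: sw; rewrite leqnn.
  by move=> i /andP[i1 i_n]; apply: sw; rewrite i1 ltnW.
by rewrite leq_eqVlt => /predU1P[->//|i_n]; apply: sw; rewrite i1.
Qed.

Lemma g_past_stay n m : (m <= n)%N -> <<s past X0 e n >> (stay m).
Proof.
elim: m => [_|m IHm m_n].
  rewrite (_ : stay 0 = setT).
    by apply: (@measurableT _ (g_sigma_algebraType (past X0 e n))).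
  by apply/seteqP; split => // w _ i /andP[/leq_trans /[apply]].
rewrite stayS; apply: (@measurableI _ (g_sigma_algebraType (past X0 e n))).
  exact: IHm (ltnW m_n).
rewrite (_ : [set _ | _] = setT `&` X m.+1 @^-1` `]-oo, x]%classic).
  exact: (g_past_process n m.+1 m_n).
by rewrite setTI; apply/seteqP; split => w /=; rewrite in_itv.
Qed.

Lemma g_past_measurable n : <<s past X0 e n >> `<=` measurable.
Proof.
by apply: smallest_sub; [exact: sigma_algebra_measurable|exact: past_measurable].
Qed.

Lemma measurable_process n : measurable_fun setT (X n).
Proof.
by move=> _ B mB; apply: (@g_past_measurable n);
  exact: (g_past_process n n (leqnn n)).
Qed.

Lemma measurable_stay n : measurable (stay n).
Proof. by apply: (@g_past_measurable n); exact: g_past_stay. Qed.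

End recursion.

Theorem theorem2p2 (R : realType) (d : measure_display) (T : measurableType d)
  (P : probability T R) (r s x : R) (F f : R -> R)
  (e : nat -> T -> R) (X0 : T -> R) (X : nat -> T -> R) :
  0 < r ->
  (* e_0, e_1, ... are real random variables, i.i.d. with cdf F and pdf f *)
  (forall n, measurable_fun setT (e n)) ->
  mutual_indep P (fun n => sigma_of (e n)) ->
  (forall n t, P [set w | e n w <= t] = (F t)%:E) ->
  measurable_fun setT f -> (forall t, 0 <= f t) ->
  (forall t, (F t)%:E = (\int[lebesgue_measure]_(u in `]-oo, t]) (f u)%:E)%E) ->
  (* X_0 is a random variable, (X_0, e_0) independent of (e_1, e_2, ...) *)
  measurable_fun setT X0 ->
  indep_classes P (sigma_of (fun w => (X0 w, e 0%N w)))
    (<<s setT, \bigcup_(i in [set i : nat | (0 < i)%N]) sigma_of (e i) >>) ->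
  (* the recursion *)
  X 0%N = X0 ->
  (forall i w, (1 <= i)%N -> X i w - r * X i.-1 w = e i w + s * e i.-1 w) ->
  let u := fun n : nat =>
    fine (P [set w | forall i, (1 <= i <= n)%N -> X i w <= x]) in
  let G0 := fun y : R * R => fine (P [set w | X0 w <= y.1 /\ e 0%N w <= y.2]) in
  forall n : nat,
    (fun y : R * R => iter n (Kop r s x f) G0 y)
      @ filter_prod (pinfty_nbhs R) (pinfty_nbhs R) --> u n.
Proof.
move=> r0 me inde FE mf f0 fE mX0 indX0 X0E XS u G0 n.
have mX i : measurable_fun setT (X i) by exact: (measurable_process X0 e X r s).
have mS i : measurable (stay X x i) by exact: (measurable_stay X0 e X r s).
(* The induction is on the exact iterate at every finite [y], since the next application integrates
   over all these values; the limit is taken only at the end. *)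
rewrite (_ : (fun y => _) =
    fun y => fine (P [set w | stay X x n w /\ X n w <= y.1 /\ e n w <= y.2])).
  exact: cvg_joint_cdf_pinfty.
elim: n => [|n IHn]; apply/funext => y.
  rewrite /= /G0 X0E; congr (fine (P _)); apply/seteqP; split => w /=.
    by move=> ?; split => // i /andP[/leq_trans /[apply]].
  by case.
(* Restricting [P] to [stay X x n] absorbs the condition M_n <= x into the measure, leaving a joint
   distribution function of (X_n, e_n). *)
pose M : {finite_measure set T -> \bar R} := mrestr P (mS n).
pose nu : {finite_measure set R -> \bar R} := image_measure P (me n.+1).
rewrite iterS [iter n _ _](_ : _ =
    fun y => fine (M [set w | X n w <= y.1 /\ e n w <= y.2])); last first.
  rewrite [LHS]IHn; apply/funext => y'; congr fine; rewrite [RHS](_ : _ =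
    P ([set w | X n w <= y'.1 /\ e n w <= y'.2] `&` stay X x n))//.
  by congr (P _); apply/seteqP; split => w /= -[].
rewrite (@Kop_joint_cdf _ _ _ M nu _ _ _ _ _ _ (e n.+1))//; last 2 first.
- move=> t; rewrite -fE -(FE n.+1)
    [LHS](_ : _ = P (e n.+1 @^-1` `]-oo, t]%classic))//.
- move=> A B mA mB; set W := fun w => _.
  rewrite [LHS](_ : _ = P (W @^-1` A `&` e n.+1 @^-1` B `&` stay X x n))//.
  rewrite [M _](_ : _ = P (W @^-1` A `&` stay X x n))//.
  rewrite -setIA [in LHS](setIC _ (stay _ _ _)) setIA.
  (* The event on [W] and [stay X x n] together belong to the past up to [n], hence are independent
     of e_(n+1). *)
  apply: (past_indep P X0 e mX0 me inde indX0 n).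
    apply: (@measurableI _ (g_sigma_algebraType (past X0 e n))); last first.
      exact: (g_past_stay X0 e X r s).
    rewrite -[X in _ X]setTI.
    suff : measurable_fun setT (W : g_sigma_algebraType (past X0 e n) -> R).
      exact.
    apply: measurable_funD; apply: measurable_funM => //.
      exact: (g_past_process X0 e X r s).
    exact: g_past_noise.
  by exists B => //; rewrite setTI.
rewrite [M _](_ : _ = P ([set w | r * X n w + s * e n w + e n.+1 w <=
    Order.min y.1 x /\ e n.+1 w <= y.2] `&` stay X x n))//.
(* The bound by [Order.min y.1 x] splits in two: the part by [x] extends [stay] to [n.+1], the part
   by [y.1] is the new first coordinate. *)
congr (fine (P _)); rewrite stayS; apply/seteqP; split => w /=.
  rewrite le_min -(recE e X r s XS) => -[[/andP[Xy Xx] ey] sw].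
  by split => //; split.
by rewrite le_min -(recE e X r s XS) => -[[sw Xx] [Xy ey]]; rewrite Xy Xx.
Qed.
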